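(* Let $M,N\ge1$ be integers, $P,\sigma^2,\beta_1,\beta_2>0$, let $\mathbf{a}_1,\mathbf{a}_{2,2}\in\mathbb{C}^N$ and $\mathbf{a}_{2,1}\in\mathbb{C}^M$ have unit-modulus entries, let $\mathbf{h}_3\in\mathbb{C}^M$, and let $\mathbf{\Psi}=\mathrm{diag}(\psi_1,\dots,\psi_N)$ with $\psi_n\in\mathbb{C}$. Let $\mathbf{g}=\sqrt{\beta_1\beta_2}\,\mathbf{a}_{2,1}\mathbf{a}_{2,2}^{T}\mathbf{\Psi}\mathbf{a}_1+\mathbf{h}_3$ and define the active-RIS SNR with optimal (MMSE) combining by $$\mathrm{SNR}_{\rm A\text{-}RIS}(\mathbf{\Psi})=P\,\mathbf{g}^{H}\left(\beta_2\sigma^2\sum_{n=1}^N|\psi_n|^2\,\mathbf{a}_{2,1}\mathbf{a}_{2,1}^{H}+\sigma^2\mathbf{I}_M\right)^{-1}\mathbf{g}.$$ Then $$\mathrm{SNR}_{\rm A\text{-}RIS}(\mathbf{\Psi})=\frac{PM\beta_1\beta_2\left|\mathbf{a}_{2,2}^{T}\mathbf{\Psi}\mathbf{a}_1\right|^2-P\beta_2\sum_{n=1}^N|\psi_n|^2\,|\mathbf{h}_3^{H}\mathbf{a}_{2,1}|^2+2P\sqrt{\beta_1\beta_2}\,\Re\left(\mathbf{h}_3^{H}\mathbf{a}_{2,1}\mathbf{a}_{2,2}^{T}\mathbf{\Psi}\mathbf{a}_1\right)}{\sigma^2\left(1+\beta_2M\sum_{n=1}^N|\psi_n|^2\right)}+\frac{P\|\mathbf{h}_3\|^2}{\sigma^2}.$$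 Moreover, for fixed amplitudes $|\psi_1|,\dots,|\psi_N|$, this SNR is maximized over the phases by $$\psi_n=|\psi_n|\exp\left(\mathsf{j}\left(-\angle[\mathbf{a}_1]_n-\angle[\mathbf{a}_{2,2}]_n-\angle(\mathbf{h}_3^{H}\mathbf{a}_{2,1})\right)\right),$$ with maximum value $$\frac{PM\beta_1\beta_2\left(\sum_{n=1}^N|\psi_n|\right)^2-P\beta_2\sum_{n=1}^N|\psi_n|^2\,|\mathbf{h}_3^{H}\mathbf{a}_{2,1}|^2+2P\sqrt{\beta_1\beta_2}\,|\mathbf{h}_3^{H}\mathbf{a}_{2,1}|\sum_{n=1}^N|\psi_n|}{\sigma^2\left(1+\beta_2M\sum_{n=1}^N|\psi_n|^2\right)}+\frac{P\|\mathbf{h}_3\|^2}{\sigma^2}.$$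
   Context: $\mathsf{j}$ is the imaginary unit, $\angle z$ is the argument of $z\in\mathbb{C}$ (any value may be used if $z=0$), $[\mathbf{a}]_n$ is the $n$-th entry of $\mathbf{a}$, $(\cdot)^T$ and $(\cdot)^H$ are the transpose and conjugate transpose, $\Re$ is the real part, and $\|\cdot\|$ is the Euclidean norm. The setting is an uplink assisted by an active RIS (element $n$ multiplies its noisy received signal by $\psi_n$) with a direct user–base-station channel $\mathbf{h}_3$. *)

(* Defs.v *)
From HB Require Import structures.
From mathcomp Require Import all_boot all_order all_algebra.
From mathcomp Require Import sesquilinear spectral.
From mathcomp Require Import complex.
From mathcomp Require Import reals trigo.

Set Implicit Arguments.
Unset Strict Implicit.
Unset Printing Implicit Defensive.

Import Order.TTheory GRing.Theory Num.Theory.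

Local Open Scope ring_scope.
Local Open Scope complex_scope.
Local Open Scope sesquilinear_scope.

Section ActiveRIS.
Context {R : realType}.

Definition expj (t : R) : R[i] := cos t +i* sin t.

(* t is one of the values of the argument of z; no branch is selected, and every
   t is an argument of 0. *)
Definition is_arg (z : R[i]) (t : R) : Prop := z = `|z| * expj t.

Lemma is_arg_ex (z : R[i]) : exists t, is_arg z t.
Proof.
case: (eqVneq z 0) => [->|z0]; first by exists 0; rewrite /is_arg normr0 mul0r.
case: z z0 => x y z0; pose r := Num.sqrt (x ^+ 2 + y ^+ 2).
have s_ge0 : 0 <= x ^+ 2 + y ^+ 2 by rewrite addr_ge0 ?sqr_ge0.
have r_gt0 : 0 < r.
  by have := z0; rewrite -normr_gt0 normc_def /= ltcE /= => /andP[].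
have r0 : r != 0 by rewrite gt_eqF.
have rE : r ^+ 2 = x ^+ 2 + y ^+ 2 by rewrite sqr_sqrtr.
have xr : -1 <= x / r <= 1.
  rewrite -ler_norml normrM normfV (gtr0_norm r_gt0) ler_pdivrMr // mul1r.
  by rewrite -sqrtr_sqr ler_wsqrtr // lerDl sqr_ge0.
have yr : r * Num.sqrt (1 - (x / r) ^+ 2) = `|y|.
  rewrite -{1}(gtr0_norm r_gt0) -sqrtr_sqr -sqrtrM ?sqr_ge0 // mulrBr mulr1.
  by rewrite -exprMn [r * _]mulrC divfK // rE addrAC subrr add0r sqrtr_sqr.
have [y0|y0] := leP 0 y.
- exists (acos (x / r)); rewrite /is_arg /expj normc_def /= -/r acosK //.
  rewrite sin_acos //; apply/eqP; rewrite eq_complex /= !mul0r subr0 addr0.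
  by rewrite yr ger0_norm // [r * _]mulrC divfK // !eqxx.
- exists (- acos (x / r)); rewrite /is_arg /expj normc_def /= -/r cosN sinN.
  rewrite acosK // sin_acos //; apply/eqP; rewrite eq_complex /= !mul0r subr0.
  by rewrite addr0 mulrN yr ltr0_norm // opprK [r * _]mulrC divfK // !eqxx.
Qed.

Definition l2norm n (v : 'cV[R[i]]_n) : R[i] :=
  sqrtC (\sum_(i < n) `|v i 0| ^+ 2).

Variables (M N : nat).

Definition ris_channel (beta1 beta2 : R) (a1 a22 : 'cV[R[i]]_N)
    (a21 h3 : 'cV[R[i]]_M) (psi : 'rV[R[i]]_N) : 'cV[R[i]]_M :=
  (Num.sqrt (beta1 * beta2))%:C *: (a21 *m a22^T *m diag_mx psi *m a1) + h3.

Definition ris_noise_cov (sigma2 beta2 : R) (a21 : 'cV[R[i]]_M)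
    (psi : 'rV[R[i]]_N) : 'M[R[i]]_M :=
  (beta2%:C * sigma2%:C * \sum_(n < N) `|psi 0 n| ^+ 2) *: (a21 *m a21 ^t*)
  + sigma2%:C *: 1%:M.

(* invmx is the identity on singular matrices; for 0 < sigma2 and 0 <= beta2
   the noise covariance is positive definite, so this is a genuine inverse.
   The value lives in R[i]: it is kept as the entry of the product, without
   taking a real part. *)
Definition snr_aris (P sigma2 beta1 beta2 : R) (a1 a22 : 'cV[R[i]]_N)
    (a21 h3 : 'cV[R[i]]_M) (psi : 'rV[R[i]]_N) : R[i] :=
  let g := ris_channel beta1 beta2 a1 a22 a21 h3 psi in
  P%:C * (g ^t* *m invmx (ris_noise_cov sigma2 beta2 a21 psi) *m g) 0 0.

End ActiveRIS.

(* Main.v *)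
Require Import Defs.
From HB Require Import structures.
From mathcomp Require Import all_boot all_order all_algebra.
From mathcomp Require Import sesquilinear spectral.
From mathcomp Require Import complex.
From mathcomp Require Import reals trigo.
From mathcomp Require Import ring.

(** Up to a scalar the noise covariance is the identity plus a rank-one term, so
    the Sherman-Morrison formula inverts it and the SNR becomes an explicit
    function of |t|, Re(c t) and the amplitudes, where t = a22^T Psi a1 and
    c = h3^H a21.  It is nondecreasing in |t| and Re(c t).  For prescribed
    amplitudes |t| <= S1 and Re(c t) <= |c| S1, where S1 is the sum of the
    amplitudes, and the proposed phases attain both bounds at once, since they
    give t = exp(- j arg c) S1. *)

Import Order.TTheory GRing.Theory Num.Theory.

Local Open Scope ring_scope.
Local Open Scope sesquilinear_scope.

(** Since [u *m v] squares to [m] times itself, the combinations of it with the identity are closed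
    under products, and the inverse can be sought among them. One product [A *m B = 1%:M] suffices:
    for square matrices it makes [A] a unit, so [invmx] is not at its default value. *)
Lemma invmx_scalar_rank1 (F : fieldType) n (u : 'cV[F]_n) (v : 'rV[F]_n)
    (k s : F) :
  s != 0 -> s + k * (v *m u) 0 0 != 0 ->
  invmx (k *: (u *m v) + s *: 1%:M) =
  s^-1 *: (1%:M - (k / (s + k * (v *m u) 0 0)) *: (u *m v)).
Proof.
set m := (v *m u) 0 0 => s0 d0.
set A := k *: _ + _; set B := s^-1 *: _.
have uvuv : u *m v *m (u *m v) = m *: (u *m v).
  by rewrite mulmxA -(mulmxA u) [v *m u]mx11_scalar mul_mx_scalar scalemxAl.
have AB : A *m B = 1%:M.
  rewrite -scalemxAr mulmxBr mulmx1 mulmxDl -!scalemxAl -!scalemxAr uvuv mul1mx.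
  rewrite !scalerA addrAC -scalerDl -scalerBl scalerDr !scalerA mulVf //.
  suff -> :
      s^-1 * (k - (k * (k / (s + k * m)) * m + s * (k / (s + k * m)))) = 0.
    by rewrite scale0r add0r scale1r.
  by field; rewrite s0 d0.
have /mulmx1_unit [Au _] := AB.
by rewrite -[LHS]mulmx1 -AB mulmxA mulVmx // mul1mx.
Qed.

Lemma trmxC_mul (C : numClosedFieldType) m n p (A : 'M[C]_(m, n))
    (B : 'M[C]_(n, p)) : (A *m B) ^t* = B ^t* *m A ^t*.
Proof. by rewrite trmx_mul map_mxM. Qed.

(** The RIS path reaches the receiver along [a] only, hence the shape [z *: a + h]. After the
    inversion only g^H g and g^H a a^H g remain; the latter is the squared modulus of a^H g = z m +
    c^*. *)
Lemma quad_form_scalar_rank1 (C : numClosedFieldType) n (a h : 'cV[C]_n)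
    (k s z : C) :
  let m := (a ^t* *m a) 0 0 in
  let c := (h ^t* *m a) 0 0 in
  let g := z *: a + h in
  s != 0 -> s + k * m != 0 ->
  (g ^t* *m invmx (k *: (a *m a ^t*) + s *: 1%:M) *m g) 0 0 =
  (`|z| ^+ 2 * m + 2 * 'Re (c * z) + (h ^t* *m h) 0 0
   - k / (s + k * m) * `|z * m + c^* | ^+ 2) / s.
Proof.
move=> m c g s0 d0; rewrite invmx_scalar_rank1 //.
have conj00 (A : 'M[C]_1) : (A ^t*) 0 0 = (A 0 0)^* by rewrite !mxE.
have aa : a ^t* *m a = m%:M by exact: mx11_scalar.
have ah : a ^t* *m h = (c^* )%:M.
  by rewrite [LHS]mx11_scalar -conj00 trmxC_mul trmxCK.
have ag : a ^t* *m g = (z * m + c^* )%:M.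
  by rewrite mulmxDr -scalemxAr aa ah scale_scalar_mx raddfD.
have ga : g ^t* *m a = ((z * m + c^* )^* )%:M.
  by rewrite [LHS]mx11_scalar -(trmxCK a) -trmxC_mul conj00 ag mxE.
have hg : h ^t* *m g = (c * z + (h ^t* *m h) 0 0)%:M.
  rewrite mulmxDr -scalemxAr raddfD /= -mx11_scalar; congr (_ + _).
  by rewrite [h ^t* *m a]mx11_scalar scale_scalar_mx mulrC.
have gg : g ^t* *m g =
    (`|z| ^+ 2 * m + 2 * 'Re (c * z) + (h ^t* *m h) 0 0)%:M.
  have hhJ : ((h ^t* *m h) 0 0)^* = (h ^t* *m h) 0 0.
    by rewrite -conj00 trmxC_mul trmxCK.
  have gh : g ^t* *m h = ((c * z + (h ^t* *m h) 0 0)^* )%:M.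
    have -> : g ^t* *m h = (h ^t* *m g) ^t* by rewrite trmxC_mul trmxCK.
    by rewrite hg [LHS]mx11_scalar conj00 mxE.
  (* Only the right factor is unfolded, so that [ga] and [gh] apply to the left one. *)
  rewrite {2}/g mulmxDr -scalemxAr ga gh scale_scalar_mx -raddfD; congr _%:M.
  rewrite ReE normCK !rmorphD !rmorphM /= conjCK hhJ.
  have -> : m^* = m by rewrite -conj00 trmxC_mul trmxCK.
  by field.
rewrite -scalemxAr -scalemxAl mulmxBr mulmxBl mulmx1 -scalemxAr -scalemxAl.
rewrite !mulmxA ga -mulmxA ag gg -scalar_mxM !scale_scalar_mx -raddfB /=.
rewrite scale_scalar_mx mxE eqxx mulr1n -/m.
rewrite [`|z * m + _| ^+ 2]normCK mulrC; congr (_ * _).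
by congr (_ - _ * _); rewrite mulrC.
Qed.

Local Open Scope complex_scope.

Section Phasors.
Variable R : realType.
Implicit Types x y : R.

Lemma expjD x y : expj (x + y) = expj x * expj y.
Proof.
rewrite /expj cosD sinD; apply/eqP; rewrite eq_complex /= eqxx /=.
by rewrite addrC.
Qed.

Lemma expj0 : expj 0 = 1 :> R[i].
Proof. by rewrite /expj cos0 sin0. Qed.

Lemma norm_expj x : `|expj x| = 1.
Proof. by rewrite normc_def /= cos2Dsin2 sqrtr1. Qed.

End Phasors.

Section ActiveRisSnr.
Variables (R : realType) (M N : nat) (P sigma2 beta1 beta2 : R).
Hypotheses (sigma2_gt0 : 0 < sigma2) (beta1_ge0 : 0 <= beta1).
Hypothesis beta2_ge0 : 0 <= beta2.
Variables (a1 a22 : 'cV[R[i]]_N) (a21 h3 : 'cV[R[i]]_M).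
Hypothesis a21_unit : forall m, `|a21 m 0| = 1.

(** Keeping x = |t| and y = Re(c t) as free arguments lets one formula serve both an arbitrary [psi]
    and the optimum, where x = S1 and y = |c| S1. *)
Definition aris_snr_of (x y S2 : R[i]) : R[i] :=
  let c := (h3 ^t* *m a21) 0 0 in
  (P%:C * M%:R * beta1%:C * beta2%:C * x ^+ 2 - P%:C * beta2%:C * S2 * `|c| ^+ 2
   + 2 * P%:C * (Num.sqrt (beta1 * beta2))%:C * y)
  / (sigma2%:C * (1 + beta2%:C * M%:R * S2))
  + P%:C * l2norm h3 ^+ 2 / sigma2%:C.

Lemma l2norm_sqr n (v : 'cV[R[i]]_n) : l2norm v ^+ 2 = (v ^t* *m v) 0 0.
Proof.
rewrite sqrtCK mxE; apply: eq_bigr => i _.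
by rewrite !mxE mulrC normCK.
Qed.

Lemma snr_arisE (psi : 'rV[R[i]]_N) :
  let t := (a22^T *m diag_mx psi *m a1) 0 0 in
  let c := (h3 ^t* *m a21) 0 0 in
  snr_aris P sigma2 beta1 beta2 a1 a22 a21 h3 psi =
  aris_snr_of `|t| ('Re (c * t)) (\sum_(n < N) `|psi 0 n| ^+ 2).
Proof.
move=> t c; rewrite /snr_aris /aris_snr_of /ris_noise_cov /ris_channel -/c.
set S2 := \sum_(n < N) _.
have aa : (a21 ^t* *m a21) 0 0 = M%:R.
  rewrite -l2norm_sqr sqrtCK (eq_bigr (fun=> 1)) ?sumr_const ?card_ord //.
  by move=> i _; rewrite a21_unit expr1n.
have S2_ge0 : 0 <= S2 by apply: sumr_ge0 => n _; rewrite exprn_ge0.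
have s0 : sigma2%:C != 0 by rewrite gt_eqF // ltcR.
have d0 : 1 + beta2%:C * M%:R * S2 != 0.
  by rewrite gt_eqF // ltr_pwDl // !mulr_ge0 ?ler0n ?lecR.
(* This is the Sherman-Morrison denominator, which factors as sigma2 (1 + beta2 M S2). *)
have d0' : sigma2%:C + beta2%:C * sigma2%:C * S2 * (a21 ^t* *m a21) 0 0 != 0.
  rewrite aa.
  have -> : sigma2%:C + beta2%:C * sigma2%:C * S2 * M%:R =
    sigma2%:C * (1 + beta2%:C * M%:R * S2) by ring.
  by rewrite mulf_neq0.
have -> : a21 *m a22^T *m diag_mx psi *m a1 = t *: a21.
  by rewrite -!mulmxA [X in _ *m X]mx11_scalar mul_mx_scalar !mulmxA.
rewrite scalerA quad_form_scalar_rank1 // -/c aa l2norm_sqr.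
set s := (Num.sqrt _)%:C.
have ss : beta1%:C * beta2%:C = s ^+ 2.
  by rewrite -rmorphXn sqr_sqrtr ?mulr_ge0 //= rmorphM.
have sJ : (s^* = s)%R.
  by apply: conj_Creal; rewrite ger0_real // lecR sqrtr_ge0.
have -> : P%:C * M%:R * beta1%:C * beta2%:C = P%:C * M%:R * s ^+ 2.
  by rewrite -ss; ring.
(* With z = s t, |z M + c^*|^2 = M (|z|^2 M + 2 Re(c z)) + |c|^2. The subtraction therefore divides
   |z|^2 M + 2 Re(c z) by 1 + beta2 M S2 and leaves - beta2 S2 |c|^2 over the same denominator. *)
rewrite !normCK !ReE !rmorphD !rmorphM /= conjCK sJ rmorph_nat.
by field; rewrite s0 d0 -aa.
Qed.

(** The negative term depends on [S2] alone, so it cancels in the comparison; the coefficients of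
    x^2 and y are nonnegative. The sign of [y] is free, as it enters linearly. *)
Lemma aris_snr_of_le (x y x' y' S2 : R[i]) :
  0 <= P -> 0 <= S2 -> 0 <= x -> x <= x' -> y <= y' ->
  aris_snr_of x y S2 <= aris_snr_of x' y' S2.
Proof.
move=> P0 S20 x0 xx' yy'; rewrite /aris_snr_of lerD2r ler_wpM2r //.
  rewrite invr_ge0; apply: mulr_ge0; first by rewrite lecR ltW.
  by rewrite addr_ge0 // !mulr_ge0 ?ler0n ?lecR.
apply: lerD; last by rewrite ler_wpM2l // !mulr_ge0 ?ler0n ?lecR ?sqrtr_ge0.
rewrite lerD2r ler_wpM2l ?mulr_ge0 ?ler0n ?lecR //.
by rewrite lerXn2r // nnegrE (le_trans x0).
Qed.

End ActiveRisSnr.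

Lemma bilinear_diag_mxE (F : pzRingType) n (u v : 'cV[F]_n) (d : 'rV[F]_n) :
  (u^T *m diag_mx d *m v) 0 0 = \sum_(i < n) u i 0 * d 0 i * v i 0.
Proof. by rewrite mul_mx_diag mxE; apply: eq_bigr => i _; rewrite !mxE. Qed.

Lemma is_arg_unit (R : realType) (z : R[i]) (x : R) :
  `|z| = 1 -> is_arg z x -> z = expj x.
Proof. by rewrite /is_arg => -> ->; rewrite mul1r. Qed.

Theorem mainTheorem9 (R : realType) (M N : nat) (hM : (1 <= M)%N)
    (hN : (1 <= N)%N) (P sigma2 beta1 beta2 : R)
    (hP : 0 < P) (hsigma2 : 0 < sigma2) (hbeta1 : 0 < beta1)
    (hbeta2 : 0 < beta2)
    (a1 a22 : 'cV[R[i]]_N) (a21 h3 : 'cV[R[i]]_M)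
    (ha1 : forall n, `|a1 n 0| = 1) (ha22 : forall n, `|a22 n 0| = 1)
    (ha21 : forall m, `|a21 m 0| = 1)
    (psi : 'rV[R[i]]_N) :
  let SNR := snr_aris P sigma2 beta1 beta2 a1 a22 a21 h3 in
  let S1 := \sum_(n < N) `|psi 0 n| in
  let S2 := \sum_(n < N) `|psi 0 n| ^+ 2 in
  let c := (h3 ^t* *m a21) 0 0 in
  SNR psi =
    (P%:C * M%:R * beta1%:C * beta2%:C
        * `|(a22^T *m diag_mx psi *m a1) 0 0| ^+ 2
      - P%:C * beta2%:C * S2 * `|c| ^+ 2
      + 2 * P%:C * (Num.sqrt (beta1 * beta2))%:C
        * 'Re ((h3 ^t* *m a21 *m a22^T *m diag_mx psi *m a1) 0 0))
    / (sigma2%:C * (1 + beta2%:C * M%:R * S2))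
    + P%:C * l2norm h3 ^+ 2 / sigma2%:C
  /\
  forall (arg_a1 arg_a22 : 'I_N -> R) (arg_c : R),
    (forall n, is_arg (a1 n 0) (arg_a1 n)) ->
    (forall n, is_arg (a22 n 0) (arg_a22 n)) ->
    is_arg c arg_c ->
    let psi_opt : 'rV[R[i]]_N :=
      \row_(n < N) (`|psi 0 n| * expj (- arg_a1 n - arg_a22 n - arg_c)) in
    [/\ (forall n, `|psi_opt 0 n| = `|psi 0 n|),
        (forall psi' : 'rV[R[i]]_N,
           (forall n, `|psi' 0 n| = `|psi 0 n|) -> SNR psi' <= SNR psi_opt)
      & SNR psi_opt =
          (P%:C * M%:R * beta1%:C * beta2%:C * S1 ^+ 2
            - P%:C * beta2%:C * S2 * `|c| ^+ 2
            + 2 * P%:C * (Num.sqrt (beta1 * beta2))%:C * `|c| * S1)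
          / (sigma2%:C * (1 + beta2%:C * M%:R * S2))
          + P%:C * l2norm h3 ^+ 2 / sigma2%:C].
Proof.
move=> SNR S1 S2 c.
have triple (d : 'rV[R[i]]_N) :
    (h3 ^t* *m a21 *m a22^T *m diag_mx d *m a1) 0 0 =
    c * (a22^T *m diag_mx d *m a1) 0 0.
  by rewrite -!mulmxA mulmxA [h3 ^t* *m a21]mx11_scalar mul_scalar_mx mxE.
have SNR_E d :=
  snr_arisE _ _ _ P _ _ _ hsigma2 (ltW hbeta1) (ltW hbeta2) a1 a22 _ h3 ha21 d.
split=> [|arg_a1 arg_a22 arg_c arg1 arg22 argc psi_opt].
  by rewrite [X in 'Re X](triple psi) /SNR (SNR_E psi).
have S1_ge0 : 0 <= S1 by exact: sumr_ge0.
have norm_opt n : `|psi_opt 0 n| = `|psi 0 n|.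
  by rewrite mxE normrM norm_expj mulr1 normr_id.
(* In each summand the phases of [a1] and [a22] cancel against those of [psi_opt], so all summands
   align on the common phase [- arg_c]. *)
have t_opt : (a22^T *m diag_mx psi_opt *m a1) 0 0 = expj (- arg_c) * S1.
  rewrite bilinear_diag_mxE mulr_sumr; apply: eq_bigr => n _.
  rewrite (is_arg_unit _ _ _ (ha1 n) (arg1 n)).
  rewrite (is_arg_unit _ _ _ (ha22 n) (arg22 n)) mxE.
  rewrite mulrCA -mulrA [RHS]mulrC -!expjD; congr (_ * expj _).
  by ring.
(* No case split on c = 0 is made: [argc] gives c = |c| [expj arg_c] for any admissible [arg_c]. *)
have ct_opt : c * (expj (- arg_c) * S1) = `|c| * S1.
  by rewrite mulrA [c in LHS]argc -[_ * _ * expj _]mulrA -expjD subrr expj0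
    mulr1.
have S2_opt d : (forall n, `|d 0 n| = `|psi 0 n|) ->
    \sum_(n < N) `|d 0 n| ^+ 2 = S2.
  by move=> dE; apply: eq_bigr => n _; rewrite dE.
have SNR_opt :
    SNR psi_opt = aris_snr_of _ M P sigma2 beta1 beta2 a21 h3 S1 (`|c| * S1) S2.
  rewrite /SNR SNR_E t_opt ct_opt S2_opt // normrM norm_expj mul1r ger0_norm //.
  by rewrite (Creal_ReP _ _) // ger0_real // mulr_ge0.
split; [exact: norm_opt | move=> psi' psi'E |
  by rewrite SNR_opt -[_ * `|c| * S1]mulrA].
(* Triangle inequality, each summand having modulus [|psi 0 n|] by the unit-modulus entries. *)
have t_le : `|(a22^T *m diag_mx psi' *m a1) 0 0| <= S1.
  rewrite bilinear_diag_mxE (le_trans (ler_norm_sum _ _ _)) // ler_sum //.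
  by move=> n _; rewrite !normrM ha1 ha22 mul1r mulr1 psi'E.
rewrite SNR_opt /SNR SNR_E S2_opt //.
apply: aris_snr_of_le => //; try exact: ltW.
  by apply: sumr_ge0 => n _; rewrite exprn_ge0.
(* Re(c t) <= |c t| = |c| |t| <= |c| S1. *)
by rewrite (le_trans (leif_Re_Creal _)) // normrM ler_wpM2l.
Qed.
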